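(* For every proper interval graph $G$, the upper clique transversal number of $G$ is equal to the induced matching number of its vertex-clique incidence graph $B_G$.
   Context: All graphs are finite, simple, undirected, and have at least one vertex. A graph $G=(V,E)$ is a proper interval graph if there is a family $(I_v : v\in V)$ of closed intervals on the real line, no one of which contains another, such that two distinct vertices $u,v$ are adjacent if and only if $I_u\cap I_v\ne\emptyset$. A clique is a set of pairwise adjacent vertices; it is maximal if it is not properly contained in another clique. A clique transversal in $G$ is a set of vertices intersecting every maximal clique of $G$; it is minimal if it does not contain any other clique transversal. The upper clique transversal number of $G$ is the maximum size of a minimal clique transversal in $G$. The vertex-clique incidence graph $B_G$ of $G$ is the bipartite graph with parts $X=V(G)$ and $Y=\mathcal{C}_G$, the set of maximal cliques of $G$, in which $x\in X$ and $C\in \mathcal{C}_G$ are adjacent if and only if $x\in C$. An induced matching in a graph is a set $M$ of pairwise disjoint edges such that the set of endpoints of edges in $M$ induces no edges other than those in $M$. The induced matching number of a graph is the maximum size of an induced matching in it. *)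

(* Defs.v *)
From HB Require Import structures.
From mathcomp Require Import all_boot all_order all_algebra.
From mathcomp Require Import reals.

Set Implicit Arguments.
Unset Strict Implicit.
Unset Printing Implicit Defensive.

Import Order.TTheory GRing.Theory Num.Theory.

Record sgraph := SGraph {
  vertex :> finType;
  adj : rel vertex;
  adj_sym : symmetric adj;
  adj_irr : irreflexive adj;
  vertex_gt0 : 0 < #|vertex|
}.

(* [a v <= b v] keeps the intervals nonempty. The family is indexed by the
   vertices, so noncontainment is required for every pair of distinct vertices
   (in particular, distinct vertices get distinct intervals). *)
Definition proper_interval_graph (R : realType) (G : sgraph) : Prop :=
  exists a b : G -> R,
    [/\ forall v, (a v <= b v)%R,
        forall u v, u != v -> ~ {subset `[a u, b u]%R <= `[a v, b v]%R}
      & forall u v, u != v ->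
          (adj u v <-> exists2 x : R, x \in `[a u, b u]%R & x \in `[a v, b v]%R)].

Definition clique (G : sgraph) (S : {set G}) : bool :=
  [forall x in S, forall y in S, (x != y) ==> adj x y].

Definition maximal_clique (G : sgraph) (S : {set G}) : bool :=
  maxset (@clique G) S.

Definition clique_transversal (G : sgraph) (X : {set G}) : bool :=
  [forall C : {set G}, maximal_clique C ==> (X :&: C != set0)].

Definition minimal_clique_transversal (G : sgraph) (X : {set G}) : bool :=
  minset (@clique_transversal G) X.

Definition upper_clique_transversal_number (G : sgraph) : nat :=
  \max_(X : {set G} | minimal_clique_transversal X) #|X|.

Definition edges (G : sgraph) : {set {set G}} :=
  [set [set p.1; p.2] | p : G * G & adj p.1 p.2].

Definition induced_matching (G : sgraph) (M : {set {set G}}) : bool :=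
  [&& M \subset edges G, trivIset M
    & [forall x in cover M, forall y in cover M,
         adj x y ==> ([set x; y] \in M)]].

Definition induced_matching_number (G : sgraph) : nat :=
  \max_(M : {set {set G}} | induced_matching M) #|M|.

Section VertexCliqueIncidence.
Variable G : sgraph.

Definition vc_vertex : finType := (G + {C : {set G} | maximal_clique C})%type.

Definition vc_adj (s t : vc_vertex) : bool :=
  match s, t with
  | inl x, inr C | inr C, inl x => x \in val C
  | _, _ => false
  end.

Lemma vc_adj_sym : symmetric vc_adj.
Proof. by move=> [x|C] [y|D]. Qed.

Lemma vc_adj_irr : irreflexive vc_adj.
Proof. by move=> [x|C]. Qed.

Lemma vc_vertex_gt0 : 0 < #|vc_vertex|.
Proof. by rewrite card_sum addn_gt0 vertex_gt0. Qed.

Definition vertex_clique_incidence_graph : sgraph :=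
  SGraph vc_adj_sym vc_adj_irr vc_vertex_gt0.

End VertexCliqueIncidence.

(* Main.v *)
(** Call a vertex set [X] irredundant if every [x] in [X] has a private maximal
    clique, one that meets [X] in [x] only. Irredundant sets are exactly the sets
    of vertex-side endpoints of induced matchings of [B_G], and minimal
    clique transversals are exactly the irredundant clique transversals. In a
    proper interval graph, ordering the vertices by left endpoints makes every
    maximal clique convex. If an irredundant set [X] misses a maximal clique [D],
    let [d] be the leftmost vertex of [D]. At most one [p] in [X] has its
    private clique containing [d], and such a [p] lies to the left of [d]: so one
    may add [d] to [X], or else replace [p] by [d], keeping irredundance. Both
    moves increase the sum of the (positive) positions, so the process stops, at
    a minimal clique transversal at least as large as the initial set. *)
Require Import Defs.
From mathcomp Require Import all_boot all_order all_algebra.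
From mathcomp Require Import reals.

Set Implicit Arguments.
Unset Strict Implicit.
Unset Printing Implicit Defensive.

Import Order.TTheory.

Section Irredundant.
Variable G : sgraph.
Implicit Types (X C D : {set G}) (x y : G).

Definition private_clique X x C := maximal_clique C && (X :&: C == [set x]).

Definition irredundant X : bool :=
  [forall x in X, exists C, private_clique X x C].

Lemma private_cliqueP X x C :
  reflect [/\ maximal_clique C, x \in X, x \in C
            & forall y, y \in X -> y \in C -> y = x]
          (private_clique X x C).
Proof.
apply: (iffP andP) => [[maxC /eqP XC]|[maxC xX xC uniqx]].
  have: x \in X :&: C by rewrite XC inE.
  case/setIP=> xX xC; split=> // y yX yC.
  by apply/set1P; rewrite -XC inE yX.
split=> //; apply/eqP/setP=> y; rewrite !inE.
by apply/andP/eqP=> [[]|->] //; exact: uniqx.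
Qed.

Lemma irredundantP X :
  reflect (exists c : G -> {set G}, {in X, forall x, private_clique X x (c x)})
          (irredundant X).
Proof.
apply: (iffP forall_inP) => [priv|[c priv] x xX]; last first.
  by apply/existsP; exists (c x); exact: priv.
exists (fun x => odflt set0 [pick C | private_clique X x C]) => x xX.
case: pickP => //= none.
by case/existsP: (priv x xX) => C; rewrite none.
Qed.

(** Deleting [x] from a minimal transversal leaves some maximal clique unmet, and that clique is
    private to [x]; conversely, a private clique forces [x] into every transversal contained in
    [X]. *)
Lemma minimal_clique_transversalE X :
  minimal_clique_transversal X = clique_transversal X && irredundant X.
Proof.
apply/minsetP/andP => [[trX minX]|[trX /forall_inP priv]].
  split=> //; apply/forall_inP => x xX.
  have: ~~ clique_transversal (X :\ x).
    apply/negP=> /minX/(_ (subsetDl _ _)) eX.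
    by move: xX; rewrite -eX setD11.
  rewrite negb_forall => /existsP[C]; rewrite negb_imply negbK.
  case/andP=> maxC /eqP dis; apply/existsP; exists C.
  have only y : y \in X -> y \in C -> y = x.
    move=> yX yC; apply/eqP; apply: contraT => nyx.
    by move/setP/(_ y): dis; rewrite !inE nyx yX yC.
  have /set0Pn[y /setIP[yX yC]] := implyP (forallP trX C) maxC.
  by apply/private_cliqueP; split; rewrite // -(only y yX yC).
split=> // B trB sBX; apply/eqP; rewrite eqEsubset sBX; apply/subsetP=> x xX.
have /existsP[C /private_cliqueP[maxC _ _ only]] := priv x xX.
have /set0Pn[y /setIP[yB yC]] := implyP (forallP trB C) maxC.
by rewrite -(only y (subsetP sBX y yB) yC).
Qed.

Lemma maximal_clique_neq0 C : maximal_clique C -> C != set0.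
Proof.
case/maxsetP=> _ maxC; apply/eqP=> C0.
have /card_gt0P[v _] := vertex_gt0 G.
have cl1 : clique [set v].
  apply/forall_inP=> x /set1P->; apply/forall_inP=> y /set1P->.
  by rewrite eqxx.
have sC1 : C \subset [set v] by rewrite C0 sub0set.
by move/setP/(_ v): (maxC _ cl1 sC1); rewrite C0 !inE eqxx.
Qed.

Lemma maximal_clique_max C D :
  maximal_clique C -> maximal_clique D -> C \subset D -> D = C.
Proof. by case/maxsetP=> _ maxC /maxsetp clD; exact: maxC. Qed.

Lemma maximal_cliqueI C v :
  maximal_clique C -> {in C, forall x, x != v -> adj x v} -> v \in C.
Proof.
case/maxsetP=> /forall_inP clC maxC adjv.
suff clvC : clique (v |: C) by rewrite -(maxC _ clvC (subsetUr _ _)) setU11.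
apply/forall_inP=> x /setU1P xvC; apply/forall_inP=> y /setU1P yvC.
apply/implyP=> nxy; case: xvC yvC nxy => [->|xC] [->|yC] nxy.
- by rewrite eqxx in nxy.
- by rewrite adj_sym adjv // eq_sym.
- exact: adjv.
- by have /forall_inP/(_ y yC)/implyP := clC x xC; apply.
Qed.

Section Convex.
Variable pos : G -> nat.
(** Positions may tie: with [u = w], vertices of equal position lie in the same maximal cliques. *)
Hypothesis convex : forall C, maximal_clique C -> forall u v w,
  u \in C -> w \in C -> pos u <= pos v <= pos w -> v \in C.

Lemma irredundant_improve X : irredundant X -> ~~ clique_transversal X ->
  exists Y, [/\ irredundant Y, #|X| <= #|Y|
              & \sum_(x in X) (pos x).+1 < \sum_(x in Y) (pos x).+1].
Proof.
case/irredundantP=> c priv.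
rewrite negb_forall => /existsP[D]; rewrite negb_imply negbK.
case/andP=> maxD /eqP XD0.
have XD x : x \in X -> x \in D -> False.
  by move=> xX xD; move/setP/(_ x): XD0; rewrite !inE xX xD.
have /set0Pn[d0 d0D] := maximal_clique_neq0 maxD.
have [d dD dmin] := arg_minnP pos d0D.
have dX : d \notin X by apply/negP=> dX; apply: (XD d).
(* Were [y] at or right of [d], any [z] in [D] beyond [y] would put [y] in [D] by convexity. So [D]
   lies between [d] and [y], hence inside [c y], and maximality gives [D = c y], which contains
   [y]. *)
have left y : y \in X -> d \in c y -> pos y < pos d.
  move=> yX dcy; rewrite ltnNge; apply/negP=> le_dy.
  have [maxcy _ ycy _] := private_cliqueP _ _ _ (priv y yX).
  suff sDc : D \subset c y.
    by apply: (XD y) => //; rewrite -(maximal_clique_max maxD maxcy sDc).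
  apply/subsetP=> z zD; apply: (convex maxcy dcy ycy); rewrite dmin //=.
  case: leqP => // /ltnW le_yz; case: (XD y yX).
  by apply: (convex maxD dD zD); rewrite le_dy.
(* Both [y] and [d] lie in [c y] and [p] is positioned between them, so [p] is in [c y]. *)
have sep y p : y \in X -> p \in X -> d \in c y -> d \in c p -> pos y <= pos p ->
    p = y.
  move=> yX pX dcy dcp le_yp.
  have [maxcy _ ycy only] := private_cliqueP _ _ _ (priv y yX).
  by apply: only => //; apply: (convex maxcy ycy dcy); rewrite le_yp ltnW ?left.
case: (boolP [exists p in X, d \in c p]) => [/exists_inP[p pX dcp]|].
  have dY : d \notin X :\ p by rewrite !inE (negPf dX) andbF.
  exists (d |: X :\ p); split; last first.
  - rewrite (big_setU1 _ dY) /= (big_setD1 p pX) /= ltn_add2r ltnS.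
    exact: left.
  - by rewrite cardsU1 dY (cardsD1 p X) pX.
  (* The new vertex [d] inherits [c p]; by [sep], no other private clique contains [d]. *)
  apply/irredundantP; exists (fun y => if y == d then c p else c y).
  have [maxcp _ pcp onlyp] := private_cliqueP _ _ _ (priv p pX).
  move=> y yY; have [->|nyd] := eqVneq y d; apply/private_cliqueP.
    split; rewrite ?setU11 // => z /setU1P[//|/setD1P[nzp zX]] zcp.
    by rewrite (onlyp z) ?eqxx // in nzp.
  have /setD1P[nyp yX] : y \in X :\ p by move: yY; rewrite inE in_set1 (negPf nyd).
  have [maxcy _ ycy only] := private_cliqueP _ _ _ (priv y yX).
  split=> // z /setU1P[->|/setD1P[_ zX]]; last exact: only.
  move=> dcy; case/eqP: nyp.
  by case/orP: (leq_total (pos y) (pos p)) => /sep ->.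
rewrite negb_exists => /forallP none.
exists (d |: X); split; last first.
(* The [.+1] makes the weight grow strictly even when [pos d] is 0. *)
- by rewrite (big_setU1 _ dX) /= addSn ltnS leq_addl.
- by rewrite cardsU1 dX leqW.
apply/irredundantP; exists (fun y => if y == d then D else c y).
move=> y yY; have [->|nyd] := eqVneq y d; apply/private_cliqueP.
  by split; rewrite ?setU11 // => z /setU1P[//|zX] /(XD z zX).
have yX : y \in X by move: yY; rewrite inE in_set1 (negPf nyd).
have [maxcy _ ycy only] := private_cliqueP _ _ _ (priv y yX).
split=> // z /setU1P[->|zX]; last exact: only.
by move=> dcy; have := none y; rewrite yX dcy.
Qed.

(** Among irredundant sets at least as large as [X], one of maximum weight cannot be improved, so it
    is a transversal. *)
Lemma irredundant_leq_upper X :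
  irredundant X -> #|X| <= upper_clique_transversal_number G.
Proof.
move=> irrX.
have PX : irredundant X && (#|X| <= #|X|) by rewrite irrX leqnn.
case: (@arg_maxnP _ X (fun Y => irredundant Y && (#|X| <= #|Y|))
  (fun Y => \sum_(x in Y) (pos x).+1) PX) => Y /andP[irrY leXY] maxY.
case: (boolP (clique_transversal Y)) => [trY|ntrY].
  apply: leq_trans leXY _.
  by apply: leq_bigmax_cond; rewrite minimal_clique_transversalE trY.
have [Z [irrZ leYZ]] := irredundant_improve irrY ntrY.
by rewrite ltnNge [_ <= _]maxY // irrZ (leq_trans leXY).
Qed.

End Convex.

(** Pair each [x] with its private clique [c x]; privacy excludes every other edge between the
    endpoints. *)
Lemma irredundant_leq_matching X : irredundant X ->
  #|X| <= induced_matching_number (vertex_clique_incidence_graph G).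
Proof.
case/irredundantP=> c priv.
pose B := vertex_clique_incidence_graph G.
pose n x : B := if insub (c x) is Some C then inr C else inl x.
have nE x : x \in X -> exists2 C, n x = inr C & val C = c x.
  move=> xX; rewrite /n; have [maxc _ _ _] := private_cliqueP _ _ _ (priv x xX).
  by case: insubP => [C _ eC|]; [exists C | rewrite maxc].
pose e x : {set B} := [set inl x; n x].
have adjE x y : x \in X -> y \in X -> @adj B (inl x) (n y) -> x = y.
  move=> xX yX; have [C -> eC] := nE y yX; rewrite /= eC => xc.
  by have [_ _ _] := private_cliqueP _ _ _ (priv y yX); apply.
have adje x : x \in X -> @adj B (inl x) (n x).
  move=> xX; have [C -> eC] := nE x xX; rewrite /= eC.
  by have [] := private_cliqueP _ _ _ (priv x xX).
have meet x y : x \in X -> y \in X -> ~~ [disjoint e x & e y] -> x = y.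
  move=> xX yX /pred0Pn[t /andP[/set2P tx /set2P ty]].
  have [C nx eC] := nE x xX; have [D ny eD] := nE y yX.
  case: tx => -> in ty; case: ty; rewrite ?nx ?ny //; first by case.
  by move=> eCD; apply: adjE => //; rewrite ny -eCD -nx adje.
have einj : {in X &, injective e}.
  move=> x y xX yX exy; apply: meet => //; rewrite exy -setI_eq0 setIid.
  by apply/set0Pn; exists (inl y); rewrite set21.
rewrite -(card_in_imset einj); apply: leq_bigmax_cond; apply/and3P; split.
- apply/subsetP=> _ /imsetP[x xX ->].
  by apply/imsetP; exists (inl x, n x); rewrite // inE adje.
- apply/trivIsetP=> _ _ /imsetP[x xX ->] /imsetP[y yX ->].
  by apply: contraNT => /(meet _ _ xX yX) ->.
apply/forall_inP=> s /bigcupP[_ /imsetP[x xX ->] /set2P sx].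
apply/forall_inP=> t /bigcupP[_ /imsetP[y yX ->] /set2P ty].
have [C nx _] := nE x xX; have [D ny _] := nE y yX.
apply/implyP; case: sx ty => -> [] -> //.
- by move/adjE=> <- //; exact: imset_f.
- by rewrite adj_sym setUC => /adjE <- //; exact: imset_f.
- by rewrite nx ny.
Qed.

(** The vertex-side endpoints work: if [y] among them lies in the partner clique [C] of [x],
    inducedness puts the edge from [y] to [C] in [M], and disjointness identifies it with the edge
    at [x]. *)
Lemma induced_matching_irredundant
    (M : {set {set vertex_clique_incidence_graph G}}) :
  induced_matching M -> exists2 X, irredundant X & #|M| <= #|X|.
Proof.
pose B := vertex_clique_incidence_graph G.
case/and3P=> /subsetP sME trivM /forall_inP ind.
have edgeE e : e \in M -> exists x (C : {C : {set G} | maximal_clique C}),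
    e = [set (inl x : B); inr C] /\ x \in val C.
  case/sME/imsetP=> -[[x|C] [y|D]]; rewrite inE //= => xC ->.
    by exists x, D.
  by exists y, C; rewrite setUC.
exists [set x | (inl x : B) \in cover M].
  apply/forall_inP=> x; rewrite inE => xM; have /bigcupP[e eM xe] := xM.
  have [x' [C [eE xC]]] := edgeE e eM.
  have ? : x' = x by move: xe; rewrite eE => /set2P[[]|//].
  subst x'; have CM : (inr C : B) \in cover M.
    by apply/bigcupP; exists e; rewrite // eE set22.
  apply/existsP; exists (val C); apply/private_cliqueP.
  split; rewrite ?(valP C) ?inE // => y; rewrite inE => yM yC.
  have yCM : [set (inl y : B); inr C] \in M.
    by have /forall_inP/(_ _ CM)/implyP := ind _ yM; apply.
  have eqe : [set (inl y : B); inr C] = e.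
    rewrite -(def_pblock trivM yCM (set22 _ _)).
    by apply: def_pblock => //; rewrite eE set22.
  have: (inl y : B) \in e by rewrite -eqe set21.
  by rewrite eE => /set2P[[]|].
(* Each edge is recovered as the block of [M] at its vertex-side endpoint. *)
apply: leq_trans (leq_imset_card (fun x => pblock M (inl x : B)) _).
apply/subset_leq_card/subsetP=> e eM; have [x [C [eE _]]] := edgeE e eM.
have xe : (inl x : B) \in e by rewrite eE set21.
apply/imsetP; exists x; last by rewrite (def_pblock trivM eM).
by rewrite inE; apply/bigcupP; exists e.
Qed.

End Irredundant.

(** With vertices ordered by left endpoint, noncontainment makes right endpoints follow the same
    order, so the interval of [v] meets every interval of the clique. *)
Lemma proper_interval_convex (R : realType) (G : sgraph) :
  proper_interval_graph R G ->
  exists pos : G -> nat, forall C, maximal_clique C -> forall u v w,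
    u \in C -> w \in C -> pos u <= pos v <= pos w -> v \in C.
Proof.
case=> a [b [le_ab proper adjE]].
(* Counting the vertices with smaller left endpoint turns the real order into positions in [nat]. *)
exists (fun v => #|[set u | (a u < a v)%R]|) => C maxC u v w uC wC.
have le_a x y : #|[set u | (a u < a x)%R]| <= #|[set u | (a u < a y)%R]| ->
    (a x <= a y)%R.
  case: (leP (a x) (a y)) => // ltyx; rewrite leqNgt proper_card //.
  apply/properP; split; last by exists y; rewrite !inE ?ltxx.
  by apply/subsetP=> z; rewrite !inE => /lt_trans; apply.
case/andP=> /le_a le_uv /le_a le_vw.
have [<- //|nuv] := eqVneq u v.
have le_b : (b u <= b v)%R.
  rewrite leNgt; apply/negP=> lt_b; case: (proper v u); rewrite 1?eq_sym //.
  move=> z; rewrite !in_itv /= => /andP[le_az le_zb].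
  by rewrite (le_trans le_uv) //= (le_trans le_zb) // ltW.
have meet x y : x \in C -> y \in C -> (a y <= b x)%R.
  move=> xC yC; have [->|nxy] := eqVneq x y; first exact: le_ab.
  have /forall_inP clC := maxsetp maxC.
  have /forall_inP/(_ y yC)/implyP/(_ nxy) := clC x xC.
  case/(adjE _ _ nxy)=> z; rewrite !in_itv /= => /andP[_ zb] /andP[az _].
  exact: le_trans zb.
apply: maximal_cliqueI => // x xC nxv; apply/(adjE _ _ nxv).
(* The common point is the larger left endpoint: [a v <= a w <= b x] in the first case,
   [a x <= b u <= b v] in the second. *)
have [le_xv|/ltW le_vx] := leP (a x) (a v).
  exists (a v); rewrite in_itv /= ?le_xv ?lexx ?le_ab //=.
  exact: le_trans le_vw (meet _ _ xC wC).
exists (a x); rewrite in_itv /= ?lexx ?le_ab ?le_vx //=.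
exact: le_trans (meet _ _ uC xC) le_b.
Qed.

Theorem theorem5p13 (R : realType) (G : sgraph)
    (hG : proper_interval_graph R G) :
  upper_clique_transversal_number G =
  induced_matching_number (vertex_clique_incidence_graph G).
Proof.
have [pos convex] := proper_interval_convex hG.
apply/eqP; rewrite eqn_leq; apply/andP; split.
  apply/bigmax_leqP=> X; rewrite minimal_clique_transversalE => /andP[_].
  exact: irredundant_leq_matching.
apply/bigmax_leqP=> M /induced_matching_irredundant[X irrX leMX].
exact: leq_trans leMX (irredundant_leq_upper convex irrX).
Qed.
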